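(* Let $u(n,q)$, $n\ge 0$, be defined by the formal power series identity $$\sum_{n\ge 0}u(n,q)x^n=\frac{1}{\sum_{n\ge 0}q^{\binom n2}x^n}.$$ Then for every integer $n\ge 1$, $$u(n,q)=\frac{1}{q^n}\sum_{k=0}^{n-1}(-1)^{n-k}\left\langle {n-1\atop k}\right\rangle_q .$$
   Context: Let $q$ be an indeterminate. The $q$-analogs $\left\langle {n\atop k}\right\rangle_q$ of the binomial coefficients, for integers $n\ge -1$ and $k\ge 0$, are defined by the initial values $\left\langle {n\atop 0}\right\rangle_q=q^{n+1}$ for $n\ge -1$ and $\left\langle {-1\atop k}\right\rangle_q=0$ for $k>0$, and the recursion (for $n\ge 0$) $$\left\langle {n\atop k}\right\rangle_q=\sum_{j=0}^{\min(n,k)}q^{\binom{j+2}{2}}\left\langle {n-1-j\atop k-j}\right\rangle_q .$$ *)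

(* Defs.v *)
From HB Require Import structures.
From mathcomp Require Import all_boot all_order all_algebra.

Set Implicit Arguments.
Unset Strict Implicit.
Unset Printing Implicit Defensive.

Import Order.TTheory GRing.Theory Num.Theory.
Local Open Scope ring_scope.

(* A formal power series is identified with its sequence of coefficients. *)
Definition fps (R : nzRingType) := nat -> R.

Definition fps_one (R : nzRingType) : fps R := fun n => (n == 0%N)%:R.

Definition fps_mul (R : nzRingType) (f g : fps R) : fps R :=
  fun n => \sum_(i < n.+1) f i * g (n - i)%N.

(* The bracket < n over k >_q with its upper index shifted by one, so that the
   recursion is structural: qbracket_shift q m k is < m - 1 over k >_q. *)
Fixpoint qbracket_shift (R : nzRingType) (q : R) (m k : nat) : R :=
  match m, k with
  | _, 0%N => q ^+ m
  | 0%N, _ => 0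
  | n.+1, _ => \sum_(j < (minn n k).+1)
                 q ^+ 'C(j + 2, 2) * qbracket_shift q (n - j)%N (k - j)%N
  end.

(* < n over k >_q for n >= -1; the value 0 at n < -1 is a dummy. *)
Definition qbracket (R : nzRingType) (q : R) (n : int) (k : nat) : R :=
  if -1 <= n then qbracket_shift q (absz (n + 1)) k else 0.

(* The defining equations of the brackets, in their usual indexing. *)
Lemma qbracket_n0 (R : nzRingType) (q : R) (n : int) :
  -1 <= n -> qbracket q n 0 = q ^+ (absz (n + 1)).
Proof. by rewrite /qbracket => ->; case: (absz _). Qed.

Lemma qbracket_N1 (R : nzRingType) (q : R) (k : nat) :
  (0 < k)%N -> qbracket q (-1) k = 0.
Proof. by case: k. Qed.

Lemma qbracket_shiftE (R : nzRingType) (q : R) (m k : nat) :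
  qbracket q (m%:Z - 1) k = qbracket_shift q m k.
Proof. by rewrite /qbracket lerBrDr addNr subrK. Qed.

Lemma qbracket_rec (R : nzRingType) (q : R) (n k : nat) :
  qbracket q n%:Z k =
  \sum_(j < (minn n k).+1)
     q ^+ 'C(j + 2, 2) * qbracket q (n%:Z - 1 - j%:Z) (k - j)%N.
Proof.
have -> : n%:Z = n.+1%:Z - 1 by rewrite -addn1 PoszD addrK.
rewrite qbracket_shiftE.
have E (j : 'I_(minn n k).+1) :
    qbracket q (n.+1%:Z - 1 - 1 - j%:Z) (k - j)%N
    = qbracket_shift q (n - j)%N (k - j)%N.
  rewrite -qbracket_shiftE -subzn; last first.
    by rewrite (leq_trans _ (geq_minl n k)) // -ltnS.
  by rewrite -addn1 PoszD addrK addrAC.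
under [RHS]eq_bigr => j _ do rewrite E.
case: k E => [|k] _ //=.
by rewrite minn0 big_ord1 /= binn expr1 subn0; case: n => [|n]; rewrite /= ?mulr1 -?exprS.
Qed.

(* A power series with invertible constant term has a reciprocal, and only one,
   so the identity U = 1 / F does define the coefficients of U. *)
Fixpoint fps_inv (R : unitRingType) (f : fps R) (n : nat) : R :=
  match n with
  | 0%N => (f 0%N)^-1
  | m.+1 => - (\sum_(i < m.+1) fps_inv f (m - i)%N * f i.+1) / f 0%N
  end.

Lemma fps_mul_eq1 (R : unitRingType) (f u : fps R) :
  f 0%N \is a GRing.unit ->
  fps_mul u f =1 fps_one R <-> u =1 fps_inv f.
Proof.
move=> f0.
have rec (v : fps R) (m : nat) : fps_mul v f m.+1 =
    \sum_(i < m.+1) v (m - i)%N * f i.+1 + v m.+1 * f 0%N.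
  rewrite /fps_mul big_ord_recr /= subnn; congr (_ + _).
  rewrite (reindex_inj rev_ord_inj) /=; apply: eq_bigr => i _.
  by rewrite subSS subSn ?leq_subr // subKn // -ltnS.
split=> [uf n|uE [|n]].
- elim/ltn_ind: n => -[|m] IH.
    have /= := uf 0%N; rewrite /fps_mul big_ord1 /fps_one /= => h.
    by rewrite -[LHS](mulrK f0) h mul1r.
  have := uf m.+1; rewrite rec /fps_one /= => /eqP.
  rewrite addrC addr_eq0 => /eqP h.
  rewrite -[LHS](mulrK f0) h; congr (- _ / _).
  by apply: eq_bigr => i _; rewrite IH // ltnS leq_subr.
- by rewrite /fps_mul big_ord1 uE /= mulVr.
- rewrite rec uE /= divrK // /fps_one /=.
  by under eq_bigr => i _ do rewrite uE; rewrite subrr.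
Qed.

(* The field Q(q) of rational functions and its indeterminate q. *)
Definition Qq : fieldType := {fraction {poly int}}.
Definition qvar : Qq := tofrac ('X : {poly int}).

(* Main.v *)
Require Import Defs.
From HB Require Import structures.
From mathcomp Require Import all_boot all_order all_algebra.

Import Order.TTheory GRing.Theory Num.Theory.
Local Open Scope ring_scope.

(** Write [B m k] for the bracket [< m - 1 over k >_q].  Summing its recursion
    over [k] with alternating signs gives, for
    [S m = \sum_(k <= m) (-1)^(m - k) B m k], the recursion
    [S (n + 1) = - \sum_(j <= n) q^'C(j + 2, 2) S (n - j)].  Since
    ['C(j + 2, 2) = 'C(j + 1, 2) + (j + 1)], the quotients [S m / q^m] satisfy
    the recursion of the coefficients of the reciprocal of
    [\sum_n q^'C(n, 2) x^n]. *)

(** For [k = 0] only [j = 0] remains, and [q * q ^+ n] agrees with the separate clause of the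
    fixpoint. *)
Lemma qbracket_shift_rec (R : nzRingType) (q : R) (n k : nat) :
  qbracket_shift q n.+1 k =
  \sum_(j < (minn n k).+1)
     q ^+ 'C(j + 2, 2) * qbracket_shift q (n - j)%N (k - j)%N.
Proof.
case: k => [|k] //; rewrite minn0 big_ord1 /= binn expr1 subn0.
by case: n => [|n] /=; rewrite ?expr0 ?mulr1 // -exprS.
Qed.

(** The recursion lowers [m] by [j + 1] but [k] only by [j], so [m < k] persists down to [m = 0]. *)
Lemma qbracket_shift_gt (R : nzRingType) (q : R) (m k : nat) :
  (m < k)%N -> qbracket_shift q m k = 0.
Proof.
elim/ltn_ind: m k => -[|n] IH k lt_mk; first by case: k lt_mk.
rewrite qbracket_shift_rec big1 // => j _.
have : (j <= minn n k)%N by rewrite -ltnS.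
rewrite leq_min => /andP[le_jn _].
rewrite IH ?mulr0 ?ltnS ?leq_subr // ltn_sub2r ?(ltnW lt_mk) //.
by rewrite (leq_ltn_trans le_jn) ?(ltnW lt_mk).
Qed.

Lemma qbracket_shift_diag (R : nzRingType) (q : R) (m : nat) :
  qbracket_shift q m.+1 m.+1 = 0.
Proof.
rewrite qbracket_shift_rec big1 // => j _.
have : (j <= minn m m.+1)%N by rewrite -ltnS.
rewrite leq_min => /andP[le_jm _].
by rewrite qbracket_shift_gt ?mulr0 // subSn.
Qed.

(** The range includes [k = m] so that the value at [m = 0] is 1, the constant coefficient of the
    reciprocal. *)
Definition qbracket_altsum {R : nzRingType} (q : R) (m : nat) : R :=
  \sum_(k < m.+1) (-1) ^+ (m - k) * qbracket_shift q m k.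

Lemma qbracket_altsum_rec (R : comNzRingType) (q : R) (n : nat) :
  qbracket_altsum q n.+1 =
  - \sum_(j < n.+1) q ^+ 'C(j + 2, 2) * qbracket_altsum q (n - j)%N.
Proof.
rewrite /qbracket_altsum.
transitivity (\sum_(k < n.+2) \sum_(j < n.+1 | (j <= k)%N)
    (-1) ^+ (n.+1 - k) *
    (q ^+ 'C(j + 2, 2) * qbracket_shift q (n - j)%N (k - j)%N)).
  apply: eq_bigr => k _; rewrite qbracket_shift_rec mulr_sumr.
  (* The bound [minn n k] becomes a condition [j <= k] on a fixed range, so that the sums can be
     exchanged. *)
  rewrite (big_ord_widen_cond n.+1 xpredT (fun j => (-1) ^+ (n.+1 - k) *
    (q ^+ 'C(j + 2, 2) * qbracket_shift q (n - j)%N (k - j)%N))); last first.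
    by rewrite ltnS geq_minl.
  apply: eq_bigl => j /=.
  by rewrite ltnS leq_min; have := ltn_ord j; rewrite ltnS => ->.
rewrite (exchange_big_dep xpredT) //= -sumrN; apply: eq_bigr => j _.
have le_jn : (j <= n)%N by rewrite -ltnS.
rewrite -(big_geq_mkord j n.+2 xpredT (fun k => (-1) ^+ (n.+1 - k) *
    (q ^+ 'C(j + 2, 2) * qbracket_shift q (n - j)%N (k - j)%N))).
rewrite -{1}[j : nat]add0n big_addn.
have -> : (n.+2 - j = (n - j).+2)%N by rewrite !subSn // ltnW.
(* After the shift of [k] by [j], the top term has lower index [n - j + 1] above [n - j], hence
   vanishes. *)
rewrite big_mkord big_ord_recr /= addnK qbracket_shift_gt // !mulr0 addr0.
rewrite mulr_sumr -sumrN; apply: eq_bigr => k _.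
rewrite addnK mulrCA -mulrN -mulNr; congr (_ * (_ * _)).
have le_k : (k <= n - j)%N by rewrite -ltnS.
(* The exponent [n.+1 - (k + j)] exceeds [n - j - k] by one, whence the minus sign. *)
by rewrite addnC subnDA !subSn // exprS mulN1r.
Qed.

Lemma fps_inv_qbinomial (F : fieldType) (q : F) (n : nat) : q != 0 ->
  fps_inv (fun n : nat => q ^+ 'C(n, 2)) n = qbracket_altsum q n / q ^+ n.
Proof.
move=> q0; elim/ltn_ind: n => -[|n] IH /=.
  by rewrite /qbracket_altsum big_ord1 /= !expr0 invr1 !mulr1.
rewrite divr1 qbracket_altsum_rec mulNr mulr_suml; congr (- _).
apply: eq_bigr => j _; rewrite IH ?ltnS ?leq_subr //.
have le_jn : (j <= n)%N by rewrite -ltnS.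
(* The first factor normalizes the sum at [n - j]; the second cancels against ['C(j + 2, 2)]. *)
have -> : q ^+ n.+1 = q ^+ (n - j) * q ^+ j.+1 by rewrite -exprD addnS subnK.
have -> : 'C(j + 2, 2) = ('C(j.+1, 2) + j.+1)%N.
  by rewrite addn2 binS bin1 addnC.
rewrite exprD invfM mulrC -!mulrA; congr (_ * _).
by rewrite mulrCA [q ^- _ / _]mulrC mulVKf ?expf_neq0.
Qed.

Lemma qvar_neq0 : qvar != 0.
Proof. by rewrite /qvar tofrac_eq0 polyX_eq0. Qed.

Theorem mainTheorem5 (u : fps Qq)
    (hu : fps_mul u (fun n : nat => qvar ^+ 'C(n, 2)) =1 fps_one Qq)
    (n : nat) (hn : (1 <= n)%N) :
  u n = 1 / qvar ^+ n *
        \sum_(0 <= k < n) (-1) ^+ (n - k) * qbracket qvar (n%:Z - 1) k.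
Proof.
have /(fps_mul_eq1 _ (unitr1 _)) -> := hu.
rewrite fps_inv_qbinomial ?qvar_neq0 // div1r mulrC; congr (_ * _).
case: n hn => // n _.
rewrite /qbracket_altsum big_ord_recr.
(* The term [k = n.+1], absent from the theorem's sum, is zero. *)
rewrite (qbracket_shift_diag _ qvar n : qbracket_shift qvar n.+1 ord_max = 0).
rewrite mulr0 [LHS]addr0 big_mkord.
by apply: eq_bigr => k _; rewrite qbracket_shiftE.
Qed.
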